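(* Fix $r\ge 3$ and $s\ge r+1$. The only Cremona-reduced class $c=(d;m_1,\dots,m_s)\in A^{r-1}(Y^r_s)$, with $d$ and all $m_i$ non-negative, which is Cremona-equivalent to $h$ is the class $h$. Moreover, any $(1)$-Weyl line class (i.e. any class Cremona-equivalent to $h$) with positive degree and non-negative multiplicities may be brought to $h$ via a finite series of Cremona transformations $\phi_I$, each of which strictly decreases the degree.
   Context: $Y^r_s$ is the blowup of $\mathbb{P}^r$ at $s$ general points. Its group of curve classes $A^{r-1}(Y^r_s)$ is the free abelian group with basis $h$ (class of a general line) and $e_1,\dots,e_s$ ($e_i$ the class of a line in the $i$-th exceptional divisor). A class $c=dh-\sum_i m_ie_i$ is also written $(d;m_1,\dots,m_s)$; $d$ is its degree and the $m_i$ are its multiplicities. For $I\subset\{1,\dots,s\}$ with $|I|=r+1$, the standard Cremona transformation $\phi_I$ acts on $A^{r-1}(Y^r_s)$ by $dh-\sum m_ie_i\mapsto d'h-\sum m_i'e_i$, where with $t=d-\sum_{i\in I}m_i$ one has $d'=d+(r-1)t$, $m_i'=m_i+t$ for $i\in I$, $m_i'=m_i$ for $i\notin I$. The Weyl group is generated by all $\phi_I$ and the permutations of $e_1,\dots,e_s$. Two classes are Cremona-equivalent if they are in the same orbit of the Weyl group. A class is Cremona reduced if $d\ge\sum_{i\in I}m_i$ for every $(r+1)$-subset $I$ of the indices. *)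

(* Defs.v *)
From mathcomp Require Import all_boot all_order all_fingroup all_algebra.
From mathcomp Require Import ring.

Set Implicit Arguments.
Unset Strict Implicit.
Unset Printing Implicit Defensive.
Import Order.TTheory GRing.Theory Num.Theory.
Local Open Scope ring_scope.

(** The group A^{r-1}(Y^r_s) of curve classes.  It is free abelian on the
    classes h, e_1, ..., e_s whatever r is, so r is not a parameter of the type.
    The pair (d, m) stands for (d; m_1, ..., m_s), that is, for
    d h - sum_i m_i e_i: the multiplicities are the opposites of the
    coordinates on the e_i. *)
Definition curve_class (s : nat) : Type := (int * {ffun 'I_s -> int})%type.

Definition cdeg (s : nat) (c : curve_class s) : int := c.1.

Definition cmult (s : nat) (c : curve_class s) (i : 'I_s) : int := c.2 i.

Definition line_class (s : nat) : curve_class s := (1, [ffun=> 0]).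

Definition exc_class (s : nat) (j : 'I_s) : curve_class s :=
  (0, [ffun i => - (i == j)%:Z]).

Lemma curve_class_basis (s : nat) (c : curve_class s) (d : int)
    (m : 'I_s -> int) :
  c = line_class s *~ d - \sum_(i < s) exc_class i *~ m i
  <-> cdeg c = d /\ forall i, cmult c i = m i.
Proof.
have zfst (x : curve_class s) (n : int) : (x *~ n).1 = x.1 *~ n.
  by rewrite -[LHS]/(fst (x *~ n)) raddfMz.
have zsnd (x : curve_class s) (n : int) i : (x *~ n).2 i = x.2 i *~ n.
  rewrite -[(x *~ n).2]/(snd (x *~ n)) raddfMz /=.
  by case: n => n; rewrite ?NegzE ?mulrNz -?pmulrn ?ffunE ?ffunMnE.
have E : line_class s *~ d - \sum_(i < s) exc_class i *~ m i
         = (d, [ffun i => m i]).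
  apply/eqP; rewrite -pair_eqE; apply/andP; split; apply/eqP.
    rewrite /= zfst (raddf_sum fst) big1 ?subr0 /= ?mulrzz ?mul1r //.
    by move=> i _; rewrite zfst mul0rz.
  apply/ffunP=> i; rewrite [RHS]ffunE /= !ffunE zsnd ffunE mul0rz add0r.
  rewrite (raddf_sum snd) sum_ffunE (bigD1 i) //= big1 ?addr0.
    by rewrite zsnd ffunE eqxx mulNrz opprK mulrzz mul1r.
  by move=> j /negPf nij; rewrite zsnd ffunE eq_sym nij oppr0 mul0rz.
rewrite E; split=> [-> | [<- cm]]; first by split=> // i; rewrite /cmult ffunE.
case: c cm {E} => d' m' cm; congr pair.
by apply/ffunP=> i; rewrite ffunE -cm.
Qed.

(** The standard Cremona transformation phi_I.  The formula makes sense for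
    every I, but it is phi_I only when #|I| = r.+1; all uses assume this. *)
Definition cremona (r s : nat) (I : {set 'I_s}) (c : curve_class s) :
    curve_class s :=
  let t := cdeg c - \sum_(i in I) cmult c i in
  (cdeg c + (r%:Z - 1) * t,
   [ffun i => if i \in I then cmult c i + t else cmult c i]).

(** The permutation e_i |-> e_(p i) of the basis. *)
Definition permute_class (s : nat) (p : 'S_s) (c : curve_class s) :
    curve_class s :=
  (cdeg c, [ffun i => cmult c ((p^-1)%g i)]).

Lemma permute_exc_class (s : nat) (p : 'S_s) (j : 'I_s) :
  permute_class p (exc_class j) = exc_class (p j).
Proof.
congr pair; apply/ffunP=> i; rewrite !ffunE /=.
by rewrite /cmult ffunE (can2_eq (permKV p) (permK p)).
Qed.

Lemma cremonaK (r s : nat) (I : {set 'I_s}) :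
  #|I| = r.+1 -> involutive (@cremona r s I).
Proof.
move=> cI [d m]; rewrite /cremona /cdeg /cmult /=.
set t := d - _.
have -> : \sum_(i in I) [ffun i => if i \in I then m i + t else m i] i
          = \sum_(i in I) m i + t *+ r.+1.
  rewrite -cI -sumr_const -big_split /=; apply: eq_bigr => i iI.
  by rewrite ffunE iI.
have -> : d + (r%:Z - 1) * t - (\sum_(i in I) m i + t *+ r.+1) = - t.
  rewrite -[t *+ _]mulr_natl -natr1 natz /t; ring.
congr pair; first by ring.
by apply/ffunP=> i; rewrite !ffunE; case: (i \in I) => /=; rewrite ?addrK.
Qed.

(** The subgroup of the automorphisms of the group of curve classes generated
    by the phi_I and the permutations; [Weyl_inv] is closure under inverses. *)
Inductive in_Weyl (r s : nat) : (curve_class s -> curve_class s) -> Prop :=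
| Weyl_id : in_Weyl r id
| Weyl_cremona (I : {set 'I_s}) : #|I| = r.+1 -> in_Weyl r (cremona r I)
| Weyl_perm (p : 'S_s) : in_Weyl r (permute_class p)
| Weyl_comp f g : in_Weyl r f -> in_Weyl r g -> in_Weyl r (f \o g)
| Weyl_inv f g : in_Weyl r f -> cancel f g -> cancel g f -> in_Weyl r g.

Definition cremona_equiv (r s : nat) (c c' : curve_class s) : Prop :=
  exists w, in_Weyl r w /\ w c = c'.

Definition cremona_reduced (r s : nat) (c : curve_class s) : Prop :=
  forall I : {set 'I_s}, #|I| = r.+1 -> \sum_(i in I) cmult c i <= cdeg c.

(** The (1)-Weyl line classes. *)
Definition Weyl_line (r s : nat) (c : curve_class s) : Prop :=
  cremona_equiv r c (line_class s).

(** [c'] is obtained from [c] by a finite, possibly empty, series of Cremona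
    transformations each of which strictly decreases the degree. *)
Inductive cremona_descent (r s : nat) :
    curve_class s -> curve_class s -> Prop :=
| descent_nil c : cremona_descent r c c
| descent_cons (I : {set 'I_s}) c c' :
    #|I| = r.+1 -> cdeg (cremona r I c) < cdeg c ->
    cremona_descent r (cremona r I c) c' -> cremona_descent r c c'.

(* Main.v *)
Require Import Defs.
From mathcomp Require Import all_boot all_order all_fingroup all_algebra.
From mathcomp Require Import ring lra zify.
(** The Weyl group acts on curve classes as a reflection group.  Its simple
    reflections are the Cremona transformation based at the first r+1 points
    and the transpositions of consecutive points; each has the form
    c |-> c + root(c) coroot, where the roots are H - E_1 - ... - E_(r+1) and
    E_k - E_(k+1).  The Dynkin diagram is simply laced, and h is dominant:
    every simple root is non-negative on it.  The theorem is then the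
    uniqueness of the dominant element of an orbit, made algorithmic.

    Say that c descends to h if simple reflections at negative roots lead
    from c to h.  The rank-two relations (commutation or braid) give a diamond
    property: if c descends to h in n+1 steps, then after any reflection of c
    at a negative root, n steps remain (simple_descent_step).  A simple
    reflection either fixes c, or is such a step, or is the inverse of such a
    step, so the classes that descend to h are stable under simple
    reflections, hence under the whole Weyl group
    (simply_reaches_line_Weyl): they form the orbit of h.

    Along a descent, a Cremona step strictly lowers the degree, by r-1 times
    the opposite of the root.  The transpositions in between can be
    absorbed, since permuting the points turns phi_I into phi_(p(I)) and fixes
    h.  So every Weyl line class reaches h by degree-lowering Cremona
    transformations (Weyl_line_descent).  A Cremona-reduced class admits no
    such transformation, so if it lies in the orbit it is already h. *)

Set Implicit Arguments.
Unset Strict Implicit.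
Unset Printing Implicit Defensive.
Import Order.TTheory GRing.Theory Num.Theory.
Local Open Scope ring_scope.

(** * Descent under simply laced reflections *)

Definition reflection (V : zmodType) (f : V -> int) (b x : V) : V :=
  x + b *~ f x.

(** The sign convention is root a (coroot a) = -2, so that the reflection adds
    root a x times the coroot, as the Cremona transformation does. *)
Record simply_laced (V : zmodType) (A : Type) (root : A -> V -> int)
    (coroot : A -> V) : Prop := SimplyLaced {
  rootDz : forall a x y (n : int),
    root a (x + y *~ n) = root a x + root a y * n;
  root_self : forall a, root a (coroot a) = - 2;
  root_sym : forall a b, root a (coroot b) = root b (coroot a);
  root_off : forall a b,
    [\/ a = b, root a (coroot b) = 0 | root a (coroot b) = 1] }.

(** The number of steps is recorded because [simple_descent_step] is proved by
    induction on it: this takes the place of a termination argument. *)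
Inductive simple_descent (V : zmodType) (A : Type) (root : A -> V -> int)
    (coroot : A -> V) (h : V) : nat -> V -> Prop :=
| simple_descent_nil : simple_descent root coroot h 0 h
| simple_descent_cons n a x :
    root a x < 0 ->
    simple_descent root coroot h n (reflection (root a) (coroot a) x) ->
    simple_descent root coroot h n.+1 x.

Section SimplyLacedReflections.
Context (V : zmodType) (A : Type) (root : A -> V -> int) (coroot : A -> V).
Hypothesis sl : simply_laced root coroot.
Local Notation refl a := (reflection (root a) (coroot a)).

Lemma root_reflection a b x :
  root a (refl b x) = root a x + root a (coroot b) * root b x.
Proof. exact: (rootDz sl). Qed.

Lemma reflectionK a : involutive (refl a).
Proof.
move=> x; rewrite {1}/reflection root_reflection (root_self sl).
rewrite /reflection -addrA -mulrzDr.
by rewrite (_ : root a x + _ = 0) ?mulr0z ?addr0 //; ring.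
Qed.

Lemma reflection_comm a b x :
  root a (coroot b) = 0 -> refl a (refl b x) = refl b (refl a x).
Proof.
move=> ab0; have ba0 : root b (coroot a) = 0 by rewrite (root_sym sl).
rewrite /reflection !(rootDz sl) ab0 ba0 !mul0r !addr0.
by rewrite addrAC.
Qed.

Lemma reflection_braid a b x :
  root a (coroot b) = 1 ->
  refl a (refl b (refl a x)) = refl b (refl a (refl b x)).
Proof.
move=> ab1; have ba1 : root b (coroot a) = 1 by rewrite (root_sym sl).
rewrite /reflection !(rootDz sl) !(root_self sl) ab1 ba1 !mul1r.
rewrite -!addrA; congr (_ + _).
rewrite addrCA -mulrzDr [RHS]addrCA -[in RHS]mulrzDr [RHS]addrC.
by congr (_ *~ _ + _ *~ _); ring.
Qed.

Context (h : V).
Hypothesis dom_h : forall a, 0 <= root a h.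

(** The diamond property.  Let the given descent start with a, and let b be
    another simple root negative at x.  If a and b are orthogonal, b can be
    performed second in the given descent, by induction, and then exchanged
    with a.  Otherwise, by induction, the descent can be made to start with
    a, b, a, which equals b, a, b.  Dominance of h keeps the descent from
    ending too early. *)
Lemma simple_descent_step n x b :
  simple_descent root coroot h n x -> root b x < 0 ->
  exists2 m, n = m.+1 & simple_descent root coroot h m (refl b x).
Proof.
elim/ltn_ind: n x b => n IH x b dx.
case: dx IH => [|{x}{}n a x ax dx] IH bx.
  by have := dom_h b; rewrite leNgt bx.
exists n => //.
case: (root_off sl a b) => [<- // | ab | ab].
  have ba : root b (coroot a) = 0 by rewrite (root_sym sl).
  have := IH n (ltnSn n) _ b dx; rewrite root_reflection ba mul0r addr0.
  case=> // m -> dm; apply: (@simple_descent_cons _ _ _ _ _ _ a).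
    by rewrite root_reflection ab mul0r addr0.
  by rewrite reflection_comm.
have ba : root b (coroot a) = 1 by rewrite (root_sym sl).
have := IH n (ltnSn n) _ b dx; rewrite root_reflection ba mul1r.
case=> [|m nm dm]; first by lra.
have := IH m _ _ a dm; rewrite !root_reflection ab ba (root_self sl).
case=> [||k mk dk]; [by rewrite nm ltnS leqnSn | lra |].
rewrite nm mk; apply: (@simple_descent_cons _ _ _ _ _ _ a).
  by rewrite root_reflection ab; lra.
apply: (@simple_descent_cons _ _ _ _ _ _ b); last by rewrite -reflection_braid.
by rewrite !root_reflection (root_self sl) ab ba; lra.
Qed.

(** According to the sign of the root, the reflection is a step of descent, the
    inverse of one, or trivial at x. *)
Lemma simple_descent_reflection n x a :
  simple_descent root coroot h n x ->
  exists m, simple_descent root coroot h m (refl a x).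
Proof.
move=> dx; have [ax|ax|ax] := ltrgtP (root a x) 0.
- by have [m _] := simple_descent_step dx ax; exists m.
- exists n.+1; apply: (@simple_descent_cons _ _ _ _ _ _ a).
    by rewrite root_reflection (root_self sl); lra.
  by rewrite reflectionK.
- by exists n; rewrite /reflection ax mulr0z addr0.
Qed.

End SimplyLacedReflections.

(** * Curve classes, permutations and Cremona transformations *)

Lemma cdegDz s (x y : curve_class s) (n : int) :
  cdeg (x + y *~ n) = cdeg x + cdeg y * n.
Proof.
rewrite /cdeg /= -[(y *~ n).1]/(fst (y *~ n)) raddfMz /=.
by rewrite -mulrzz.
Qed.

Lemma cmultDz s (x y : curve_class s) (n : int) i :
  cmult (x + y *~ n) i = cmult x i + cmult y i * n.
Proof.
rewrite /cmult /= ffunE -[(y *~ n).2]/(snd (y *~ n)) raddfMz /= -mulrzz.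
by congr (_ + _); case: n => n; rewrite ?NegzE ?mulrNz -?pmulrn ?ffunE ?ffunMnE.
Qed.

Lemma curve_classP s (c c' : curve_class s) :
  cdeg c = cdeg c' -> (forall i, cmult c i = cmult c' i) -> c = c'.
Proof.
case: c c' => [d m] [d' m']; rewrite /cdeg /cmult /= => -> mm.
by congr pair; apply/ffunP.
Qed.

Lemma cmult_permute s (p : 'S_s) (c : curve_class s) i :
  cmult (permute_class p c) i = cmult c ((p^-1)%g i).
Proof. by rewrite {1}/cmult ffunE. Qed.

Lemma cmult_cremona r s (I : {set 'I_s}) (c : curve_class s) i :
  cmult (cremona r I c) i
  = cmult c i + (i \in I)%:Z * (cdeg c - \sum_(j in I) cmult c j).
Proof.
by rewrite {1}/cmult ffunE; case: (i \in I); rewrite ?mul1r ?mul0r ?addr0.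
Qed.

Lemma permute_classM s (p q : 'S_s) (c : curve_class s) :
  permute_class (p * q)%g c = permute_class q (permute_class p c).
Proof. by apply: curve_classP => // i; rewrite !cmult_permute invMg permM. Qed.

Lemma permute_class1 s (c : curve_class s) : permute_class 1%g c = c.
Proof. by apply: curve_classP => // i; rewrite cmult_permute invg1 perm1. Qed.

Lemma permute_cremona r s (p : 'S_s) (I : {set 'I_s}) (c : curve_class s) :
  permute_class p (cremona r I c) = cremona r (p @: I) (permute_class p c).
Proof.
have sumE : \sum_(i in p @: I) cmult (permute_class p c) i
          = \sum_(i in I) cmult c i.
  rewrite big_imset /=; last by move=> x y _ _; apply: perm_inj.
  by apply: eq_bigr => i _; rewrite cmult_permute permK.
apply: curve_classP; first by rewrite /cdeg /= sumE.
move=> i; rewrite cmult_permute !cmult_cremona sumE cmult_permute.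
by rewrite -{4}[i](permKV p) mem_imset //; apply: perm_inj.
Qed.

Lemma permute_line s (p : 'S_s) : permute_class p (line_class s) = line_class s.
Proof.
by apply: curve_classP => // i; rewrite cmult_permute /cmult /= !ffunE.
Qed.

(** This is what makes permutations harmless in a descent to h, which they
    fix. *)
Lemma cremona_descent_perm r s (p : 'S_s) (c c' : curve_class s) :
  cremona_descent r c c' ->
  cremona_descent r (permute_class p c) (permute_class p c').
Proof.
elim=> [x|I x x' cI lt _ IH]; first exact: descent_nil.
apply: (@descent_cons _ _ (p @: I)); rewrite -?permute_cremona //.
by rewrite card_imset //; apply: perm_inj.
Qed.

(** * The simple roots of the Weyl group *)

Definition first_set (r s : nat) : {set 'I_s} := [set i : 'I_s | (i <= r)%N].

Definition lower n (k : 'I_n) : 'I_n.+1 := widen_ord (leqnSn n) k.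
Definition upper n (k : 'I_n) : 'I_n.+1 := lift ord0 k.

(** [None] is the root H - E_1 - ... - E_(r+1) and [Some k] the root of the
    transposition of the consecutive points k and k+1, as linear forms on
    curve classes. *)
Definition croot r n (a : option 'I_n) (c : curve_class n.+1) : int :=
  if a is Some k then cmult c (lower k) - cmult c (upper k)
  else cdeg c - \sum_(i in first_set r n.+1) cmult c i.

(** The second component lists multiplicities, which are the opposites of the
    coordinates on the e_i: the coroots are (r-1)h - e_1 - ... - e_(r+1) and
    e_k - e_(k+1). *)
Definition ccoroot r n (a : option 'I_n) : curve_class n.+1 :=
  if a is Some k
  then (0, [ffun i => (i == upper k)%:Z - (i == lower k)%:Z])
  else (r%:Z - 1, [ffun i => (i \in first_set r n.+1)%:Z]).

Lemma lower_upper n (k : 'I_n) : (lower k == upper k) = false.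
Proof. by rewrite -val_eqE /= /bump add1n ltn_eqF. Qed.

Lemma card_first_set r s : (r < s)%N -> #|first_set r s| = r.+1.
Proof.
move=> rs; rewrite cardsE -sum1_card.
by rewrite -(big_ord_widen _ (fun=> 1%N) rs) sum1_card card_ord.
Qed.

Lemma sum_delta s (I : {set 'I_s}) j :
  \sum_(i in I) (i == j)%:Z = (j \in I)%:Z :> int.
Proof.
have [jI|jI] := boolP (j \in I).
  by rewrite (bigD1 j) //= eqxx big1 ?addr0 // => i /andP[_ /negPf ->].
by rewrite big1 // => i iI; case: eqP iI jI => // -> ->.
Qed.

Lemma crootDz r n (a : option 'I_n) x y (k : int) :
  croot r a (x + y *~ k) = croot r a x + croot r a y * k.
Proof.
case: a => [i|]; rewrite /croot; first by rewrite !cmultDz; ring.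
rewrite cdegDz (eq_bigr _ (fun i _ => cmultDz x y k i)) big_split /= -mulr_suml.
ring.
Qed.

Lemma cmult_ccoroot_None r n i :
  cmult (ccoroot r (@None 'I_n)) i = (i \in first_set r n.+1)%:Z.
Proof. by rewrite /cmult ffunE. Qed.

Lemma cmult_ccoroot_Some r n (k : 'I_n) i :
  cmult (ccoroot r (Some k)) i = (i == upper k)%:Z - (i == lower k)%:Z.
Proof. by rewrite /cmult ffunE. Qed.

Lemma croot_None_None r n :
  (r <= n)%N -> croot r None (ccoroot r (@None 'I_n)) = - 2.
Proof.
move=> rn; rewrite /croot (eq_bigr (fun=> 1)) => [|i iI]; last first.
  by rewrite cmult_ccoroot_None iI.
rewrite sumr_const card_first_set // /cdeg /=; lia.
Qed.

Lemma croot_None_Some r n (k : 'I_n) :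
  croot r None (ccoroot r (Some k)) = (k == r :> nat)%:Z.
Proof.
rewrite /croot (eq_bigr _ (fun i _ => cmult_ccoroot_Some r k i)).
rewrite sumrB !sum_delta !inE /cdeg /= /bump; lia.
Qed.

Lemma croot_Some_None r n (k : 'I_n) :
  croot r (Some k) (ccoroot r None) = (k == r :> nat)%:Z.
Proof. rewrite /croot !cmult_ccoroot_None !inE /= /bump; lia. Qed.

Lemma croot_Some_Some r n (k l : 'I_n) :
  croot r (Some k) (ccoroot r (Some l))
  = (k == l.+1 :> nat)%:Z + (l == k.+1 :> nat)%:Z - 2 * (k == l)%:Z.
Proof. rewrite /croot !cmult_ccoroot_Some -!val_eqE /= /bump; lia. Qed.

(** The Dynkin diagram is the chain of the transpositions, with the Cremona
    root attached to the transposition of the points r+1 and r+2 if s > r+1. *)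
Lemma croot_simply_laced r n :
  (r <= n)%N -> simply_laced (@croot r n) (@ccoroot r n).
Proof.
move=> rn; split.
- exact: crootDz.
- case=> [k|]; last exact: croot_None_None.
  by rewrite croot_Some_Some eqxx ltn_eqF.
- case=> [k|] [l|] //; rewrite ?croot_Some_None ?croot_None_Some //.
  by rewrite !croot_Some_Some [_ == k]eq_sym; ring.
- case=> [k|] [l|]; rewrite ?croot_Some_None ?croot_None_Some; last first.
  + exact: Or31.
  + by case: eqP => _; [apply: Or33|apply: Or32].
  + by case: eqP => _; [apply: Or33|apply: Or32].
  + rewrite croot_Some_Some; have [->|kl] := eqVneq k l; first exact: Or31.
    have [->|_] := eqVneq (k : nat) l.+1.
      by rewrite [(l == _ :> nat)]ltn_eqF //; apply: Or33.
    by case: eqP => _; [apply: Or33|apply: Or32].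
Qed.

Lemma reflection_cremona r n (c : curve_class n.+1) :
  reflection (croot r None) (ccoroot r None) c
  = cremona r (first_set r n.+1) c.
Proof.
apply: curve_classP => [|i]; rewrite /reflection; first by rewrite cdegDz.
by rewrite cmultDz cmult_cremona {2}/cmult ffunE.
Qed.

Lemma reflection_tperm r n k (c : curve_class n.+1) :
  reflection (croot r (Some k)) (ccoroot r (Some k)) c
  = permute_class (tperm (lower k) (upper k)) c.
Proof.
apply: curve_classP => [|i]; rewrite /reflection.
  by rewrite cdegDz mul0r addr0.
rewrite cmultDz cmult_permute tpermV {2}/cmult ffunE /=.
case: tpermP => [->|->|/eqP/negPf -> /eqP/negPf ->].
- by rewrite eqxx lower_upper sub0r mulN1r opprB addrC subrK.
- by rewrite eqxx eq_sym lower_upper subr0 mul1r addrC subrK.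
- by rewrite subr0 mul0r addr0.
Qed.

(** * Invariance under the Weyl group *)

(** Consecutive transpositions generate the symmetric group. *)
Lemma perm_adjacent_ind n (P : 'S_n.+1 -> Prop) :
    P 1%g -> (forall p q, P p -> P q -> P (p * q)%g) ->
    (forall k : 'I_n, P (tperm (lower k) (upper k))) ->
  forall p, P p.
Proof.
move=> P1 PM Padj.
have Ptp d : forall i j : 'I_n.+1, (j = i + d :> nat)%N -> P (tperm i j).
  elim: d => [|d IH] i j jE.
    by rewrite (_ : j = i) ?tperm1 //; apply: val_inj; rewrite /= jE addn0.
  have dn : (i + d < n)%N by rewrite -ltnS -addnS -jE.
  pose k := Ordinal dn.
  have -> : j = upper k by apply: val_inj; rewrite /= jE /bump add1n addnS.
  have [d0|d0] := posnP d.
    rewrite (_ : i = lower k) //; apply: val_inj; by rewrite /= d0 addn0.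
  (* Conjugating by the last consecutive transposition shortens the gap. *)
  have -> : tperm i (upper k)
      = (tperm i (lower k) ^ tperm (lower k) (upper k))%g.
    rewrite tpermJ tpermL tpermD // -val_eqE /= /bump; lia.
  rewrite /conjg tpermV; apply: (PM) => //; apply: (PM) => //.
  exact: IH.
move=> p; have [ts -> _] := prod_tpermP p.
elim: ts => [|[i j] ts IH]; first by rewrite big_nil.
rewrite big_cons; apply: PM IH.
case: (leqP i j) => [ij|/ltnW ji].
  by apply: (Ptp (j - i)%N); rewrite subnKC.
by rewrite tpermC; apply: (Ptp (i - j)%N); rewrite subnKC.
Qed.

(** As long as A is not B, exchanging a point of A outside B with a point of B
    outside A brings A closer to B. *)
Lemma exists_perm_imset (T : finType) (A B : {set T}) :
  #|A| = #|B| -> exists p : {perm T}, p @: A = B.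
Proof.
elim: {A}_.+1 {-2}A (ltnSn #|A :\: B|) => // m IH A ltm cAB.
have [AB|/subsetPn[x xA xB]] := boolP (A \subset B).
  exists 1%g; apply/eqP; rewrite eqEcard card_imset ?cAB ?leqnn ?andbT.
    by apply/subsetP=> _ /imsetP[y yA ->]; rewrite perm1 (subsetP AB).
  exact: perm_inj.
have [y yB yA] : exists2 y, y \in B & y \notin A.
  apply/subsetPn; apply: contra xB => BA.
  by have /eqP -> : B == A by rewrite eqEcard BA cAB leqnn.
have memA z : (z \in tperm x y @: A) = (tperm x y z \in A).
  by rewrite -{1}[z](tpermK x y) mem_imset //; apply: perm_inj.
have [||p pA] := IH (tperm x y @: A).
- rewrite -ltnS (leq_trans _ ltm) // ltnS; apply: proper_card.
  apply/properP; split; last first.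
    by exists x; rewrite !inE ?xB ?xA // memA tpermL (negPf yA) andbF.
  apply/subsetP=> z; rewrite !inE memA => /andP[zB].
  case: tpermP => [->|zy|_ _]; rewrite ?zB ?(negPf yA) //.
  by rewrite zy yB in zB.
- by rewrite card_imset //; apply: perm_inj.
exists (tperm x y * p)%g; rewrite -pA -imset_comp; apply: eq_imset => z.
by rewrite /= permM.
Qed.

Definition simply_reaches_line r n (c : curve_class n.+1) : Prop :=
  exists m,
    simple_descent (@croot r n) (@ccoroot r n) (line_class n.+1) m c.

Lemma croot_line r n a : 0 <= croot r a (line_class n.+1).
Proof.
case: a => [k|]; first by rewrite /croot /cmult /= !ffunE subrr.
by rewrite /croot big1 // => i _; rewrite /cmult ffunE.
Qed.

Section WeylInvariance.
Context (r n : nat) (rn : (r <= n)%N).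

Lemma simply_reaches_line_permute (p : 'S_n.+1) (c : curve_class n.+1) :
  simply_reaches_line r c -> simply_reaches_line r (permute_class p c).
Proof.
elim/perm_adjacent_ind: p c => [c|p q IHp IHq c|k c].
- by rewrite permute_class1.
- by move=> rc; rewrite permute_classM; apply/IHq/IHp.
case=> m dc; rewrite -(reflection_tperm r).
exact: (simple_descent_reflection (croot_simply_laced rn) (@croot_line r n)) dc.
Qed.

(** Every phi_I is conjugate under a permutation to the simple reflection at the
    first r+1 points. *)
Lemma simply_reaches_line_cremona (I : {set 'I_n.+1}) (c : curve_class n.+1) :
  #|I| = r.+1 ->
  simply_reaches_line r c -> simply_reaches_line r (cremona r I c).
Proof.
move=> cI rc.
have [p pI] : exists p : 'S_n.+1, p @: I = first_set r n.+1.
  by apply: exists_perm_imset; rewrite card_first_set.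
have -> : cremona r I c
    = permute_class (p^-1)%g (cremona r (p @: I) (permute_class p c)).
  by rewrite -permute_cremona -permute_classM mulgV permute_class1.
apply: simply_reaches_line_permute; rewrite pI -reflection_cremona.
have [m dc] := simply_reaches_line_permute p rc.
exact: (simple_descent_reflection (croot_simply_laced rn) (@croot_line r n)) dc.
Qed.

(** An equivalence, so that the induction goes through inverses. *)
Lemma simply_reaches_line_Weyl w (c : curve_class n.+1) :
  in_Weyl r w -> simply_reaches_line r c <-> simply_reaches_line r (w c).
Proof.
move=> Ww; elim: Ww c => {w} [|I cI|p|f g _ IHf _ IHg|f g _ IHf fK gK] c //.
- split; first exact: simply_reaches_line_cremona.
  by move/(simply_reaches_line_cremona cI); rewrite cremonaK.
- split; first exact: simply_reaches_line_permute.
  move/(simply_reaches_line_permute (p^-1)%g).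
  by rewrite -permute_classM mulgV permute_class1.
- by rewrite IHg IHf.
- by rewrite (IHf (g c)) gK.
Qed.
End WeylInvariance.

(** * Degree-lowering Cremona transformations *)

Lemma cdeg_cremona_lt r s (I : {set 'I_s}) (c : curve_class s) :
  (1 < r)%N ->
  (cdeg (cremona r I c) < cdeg c) = (cdeg c < \sum_(i in I) cmult c i).
Proof.
move=> r1; rewrite {1}/cdeg /= gtrDl pmulr_rlt0 ?subr_lt0 //.
by rewrite subr_gt0 ltz_nat.
Qed.

(** A transposition met on the way is pushed to the end of the series, where it
    fixes h. *)
Lemma simple_descent_cremona r n m (c : curve_class n.+1) :
  (1 < r)%N -> (r <= n)%N ->
  simple_descent (@croot r n) (@ccoroot r n) (line_class n.+1) m c ->
  cremona_descent r c (line_class n.+1).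
Proof.
move=> r1 rn; elim=> [|{}m a {}c ac _ IH]; first exact: descent_nil.
case: a ac IH => [k|] ac; last first.
  rewrite reflection_cremona => IH; apply: descent_cons IH.
    exact: card_first_set.
  by rewrite cdeg_cremona_lt // -subr_lt0.
rewrite reflection_tperm => /(cremona_descent_perm (tperm (lower k) (upper k))).
by rewrite -permute_classM tperm2 permute_class1 permute_line.
Qed.

Lemma Weyl_line_descent r s (c : curve_class s) :
  (1 < r)%N -> (r < s)%N -> Weyl_line r c ->
  cremona_descent r c (line_class s).
Proof.
case: s c => // n c r1; rewrite ltnS => rn [w [Ww wc]].
have [|m dc] := (simply_reaches_line_Weyl rn c Ww).2.
  by rewrite wc; exists 0%N; apply: simple_descent_nil.
exact: simple_descent_cremona dc.
Qed.

Lemma cremona_reduced_descent r s (c c' : curve_class s) :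
  (1 < r)%N -> cremona_reduced r c -> cremona_descent r c c' -> c = c'.
Proof.
move=> r1 red dc; case: dc red => // I {}c {}c' cI lt _ red.
by move: lt; rewrite cdeg_cremona_lt // ltNge red.
Qed.

Theorem theorem5p10 (r s : nat) (hr : (3 <= r)%N) (hs : (r.+1 <= s)%N) :
  (forall c : curve_class s,
     [/\ 0 <= cdeg c, forall i : 'I_s, 0 <= cmult c i,
         cremona_reduced r c & cremona_equiv r c (line_class s)]
     <-> c = line_class s)
  /\
  (forall c : curve_class s,
     Weyl_line r c -> 0 < cdeg c -> (forall i : 'I_s, 0 <= cmult c i) ->
     cremona_descent r c (line_class s)).
Proof.
have r1 : (1 < r)%N by apply: ltnW.
split=> [c|c cl _ _]; last exact: Weyl_line_descent.
split=> [[_ _ red cl]|->].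
  exact: (cremona_reduced_descent r1 red (Weyl_line_descent r1 hs cl)).
have line0 i : cmult (line_class s) i = 0 by rewrite /cmult ffunE.
split=> // [i|I _|]; first by rewrite line0.
  by rewrite big1 // => i _; rewrite line0.
by exists id; split=> //; apply: Weyl_id.
Qed.
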